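(* Let $\tau_L, \delta_L, \tau_R, \delta_R \in \mathbb{R}$ with $\delta_L > 0$, $\delta_R < 0$ and $\tau_L < 2\sqrt{\delta_L}$, and let $g : \mathbb{R}^2 \to \mathbb{R}^2$ be the map $$g(x,y) = \begin{cases} (\tau_L x + y,\ -\delta_L x), & x \le 0, \\ (\tau_R x + y,\ -\delta_R x), & x \ge 0. \end{cases}$$ Let $\Gamma = \{(x, 1-x) : 0 \le x \le 1\}$, let $\Delta_0 = \{(x,y) : x \ge 0,\ y \ge 0,\ y \le 1-x\}$, and let $\Delta_n = g^n(\Delta_0)$ for $n \ge 1$ and $\Omega_n = \bigcup_{i=0}^n \Delta_i$ for $n \ge 0$. Then $\mathbf{0} = (0,0)$ is an asymptotically stable fixed point of $g$ if and only if there exist integers $m, k \ge 0$ such that $g(\Omega_m) \subset \Omega_m$ and $g^k(\Omega_m) \cap \Gamma = \varnothing$.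
   Context: $g^n$ denotes the $n$-fold composition of $g$ with itself, and for a set $X$, $g^n(X)$ is its image. $B_r$ is the open Euclidean ball of radius $r$ centred at $\mathbf{0}$ in $\mathbb{R}^2$. The fixed point $\mathbf{0}$ of $g$ is Lyapunov stable if for all $\varepsilon > 0$ there exists $\delta > 0$ such that $g^n(\mathbf{x}) \in B_\varepsilon$ for all $\mathbf{x} \in B_\delta$ and all $n \ge 0$; it is asymptotically stable if it is Lyapunov stable and there exists $\delta > 0$ such that $g^n(\mathbf{x}) \to \mathbf{0}$ as $n \to \infty$ for all $\mathbf{x} \in B_\delta$. The symbol $\subset$ allows equality. *)

(* Defs.v *)
From HB Require Import structures.
From mathcomp Require Import all_boot all_order all_algebra.
From mathcomp Require Import all_classical all_reals all_analysis.
Set Implicit Arguments.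
Unset Strict Implicit.
Unset Printing Implicit Defensive.
Import Order.TTheory GRing.Theory Num.Theory.
Import numFieldNormedType.Exports.
Local Open Scope classical_set_scope.
Local Open Scope ring_scope.

(* The library's norm on R * R is the sup norm, so the Euclidean ball is
   spelled out. The library's product topology on R * R, used below for limits,
   is the usual topology of the plane. *)
Definition eucl_norm (R : realType) (p : R * R) : R :=
  Num.sqrt (p.1 ^+ 2 + p.2 ^+ 2).

Definition eucl_ball (R : realType) (r : R) : set (R * R) :=
  [set p | eucl_norm p < r].

Definition lyapunov_stable0 (R : realType) (f : R * R -> R * R) : Prop :=
  forall eps : R, 0 < eps -> exists2 delta : R, 0 < delta &
    forall p, eucl_ball delta p -> forall n : nat, eucl_ball eps (iter n f p).

Definition asymptotically_stable0 (R : realType) (f : R * R -> R * R) : Prop :=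
  lyapunov_stable0 f /\
  exists2 delta : R, 0 < delta &
    forall p, eucl_ball delta p ->
      (fun n : nat => iter n f p) @ \oo --> ((0, 0) : R * R).

Definition gmap (R : realType) (tauL deltaL tauR deltaR : R) (p : R * R) :
    R * R :=
  if p.1 <= 0 then (tauL * p.1 + p.2, - deltaL * p.1)
  else (tauR * p.1 + p.2, - deltaR * p.1).

(* The two branches agree on x = 0. *)
Lemma gmap_right (R : realType) (tauL deltaL tauR deltaR : R) (p : R * R) :
  0 <= p.1 ->
  gmap tauL deltaL tauR deltaR p = (tauR * p.1 + p.2, - deltaR * p.1).
Proof.
rewrite /gmap => p0; case: ifPn => // p0'.
have -> : p.1 = 0 by apply/eqP; rewrite eq_le p0' p0.
by rewrite !mulr0.
Qed.

Definition Gamma (R : realType) : set (R * R) :=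
  [set (x, 1 - x) | x in [set x : R | 0 <= x <= 1]].
Arguments Gamma : clear implicits.

Definition Delta0 (R : realType) : set (R * R) :=
  [set p | [/\ 0 <= p.1, 0 <= p.2 & p.2 <= 1 - p.1]].
Arguments Delta0 : clear implicits.

Definition Delta (R : realType) (f : R * R -> R * R) (n : nat) : set (R * R) :=
  iter n f @` Delta0 R.

Definition Omega (R : realType) (f : R * R -> R * R) (n : nat) : set (R * R) :=
  \bigcup_(i < n.+1) Delta f i.

(* Main.v *)
Require Import Defs.
From HB Require Import structures.
From mathcomp Require Import all_boot all_order all_algebra.
From mathcomp Require Import all_classical all_reals all_analysis.
From mathcomp Require Import lra.
Set Implicit Arguments.
Unset Strict Implicit.
Unset Printing Implicit Defensive.
Import Order.TTheory GRing.Theory Num.Theory.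
Import numFieldNormedType.Exports.
Local Open Scope classical_set_scope.
Local Open Scope ring_scope.

(** Write Q for the closed first quadrant. Three facts about g drive the proof:
    it is continuous, it commutes with multiplication by nonnegative scalars,
    and every orbit meets Q within a bounded number N of iterations
    ([gmap_recurrent]). The last fact is where the hypotheses enter. The signs
    of deltaL and deltaR send the whole plane to the upper half plane, and
    tauL < 2 sqrt deltaL says that the left branch has no positive eigenvalue,
    so no ray of the second quadrant is invariant and points there are rotated
    into Q; [gmap_slope_step] makes the speed of this rotation explicit. The
    equivalence then holds for every map of the plane with these three
    properties. It rests on the remark that Delta0 is a unit neighbourhood of
    0 in Q: each point of Q is a multiple of a point of Delta0, by a factor
    comparable to its norm ([quadrant_simplex]).

    Trapping implies stability ([stable_of_trapping]). By homogeneity the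
    Omega_m are star-shaped about 0, so if g^k(Omega_m) misses Gamma then its
    part in Q lies below Gamma, and by compactness it lies in c Delta0 for
    some c < 1. Since orbits return to Q, every orbit from Omega_m enters
    c Delta0 at some time between k and N + k, whence g^(N + k)(Omega_m) is
    contained in c Omega_m ([Omega_contraction]). Iterating, orbits from
    Omega_m shrink geometrically, and any point of the plane reaches a
    multiple of Delta0, hence of Omega_m, in at most N steps.

    Stability implies trapping ([trapping_of_stable]). Asymptotic stability
    and compactness of Delta0 make g^n tend to 0 uniformly on Delta0
    ([uniform_attraction]), so for some M all later images of Delta0 lie in a
    small ball. A point of g^n(Delta0) with n > M + N has an ancestor at most
    N steps back that lies in Q and is small, hence lies in Delta0; so the
    point already belongs to Omega_N. This gives invariance of Omega_(M + N),
    and its image by g^M is too small to meet Gamma. *)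

(** * The simplex Delta0 inside the first quadrant *)
Definition quadrant (R : realType) : set (R * R) :=
  [set p | 0 <= p.1 /\ 0 <= p.2].

Arguments quadrant : clear implicits.

Definition positively_homogeneous (R : realType) (f : R * R -> R * R) : Prop :=
  forall (c : R) p, 0 <= c -> f (c *: p) = c *: f p.

(** The time of the visit is uniform in the starting point; this is what lets
    the two implications lose only finitely many iterates. *)
Definition recurrent_within (R : realType) (N : nat) (f : R * R -> R * R) :
    Prop :=
  forall p, exists2 j : nat, (j <= N)%N & quadrant R (iter j f p).

Section Plane.
Context {R : realType}.
Implicit Types (p q : R * R) (r : R).

(** Together with [eucl_le_norm], this lets all estimates be made in the sup
    norm that carries the topology of the product. *)
Lemma norm_le_eucl p : `|p| <= eucl_norm p.
Proof.
have h (a b : R) : `|a| <= Num.sqrt (a ^+ 2 + b ^+ 2).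
  by rewrite -sqrtr_sqr ler_sqrt ?addr_ge0 ?sqr_ge0// lerDl sqr_ge0.
by rewrite prod_normE ge_max /eucl_norm h/= addrC h.
Qed.

Lemma eucl_le_norm p : eucl_norm p <= 2 * `|p|.
Proof.
rewrite -[leRHS]ger0_norm ?mulr_ge0// -sqrtr_sqr /eucl_norm ler_sqrt ?sqr_ge0//.
have h1 : `|p.1| <= `|p| by rewrite prod_normE le_max lexx.
have h2 : `|p.2| <= `|p| by rewrite prod_normE le_max lexx orbT.
have {h1}: p.1 ^+ 2 <= `|p| ^+ 2.
  by rewrite -(real_normK (num_real p.1)) lerXn2r ?nnegrE.
have {h2}: p.2 ^+ 2 <= `|p| ^+ 2.
  by rewrite -(real_normK (num_real p.2)) lerXn2r ?nnegrE.
have := sqr_ge0 `|p|.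
rewrite exprMn. lra.
Qed.

Lemma ltr_normP (p : R * R) r : `|p| < r -> `|p.1| < r /\ `|p.2| < r.
Proof. by rewrite prod_normE gt_max => /andP[]. Qed.

Lemma Delta0_compact : compact (Delta0 R).
Proof.
have -> : Delta0 R = (`[0, 1] `*` `[0, 1]) `&`
    ((fun p : R * R => p.1 + p.2) @^-1` [set x | x <= 1]).
  apply/seteqP; split => -[x y] /=; rewrite !in_itv /=.
    by move=> [/= ? ? ?]; split; [split; apply/andP; split|]; lra.
  by move=> [[/andP[? ?] /andP[? ?]] ?]; split => /=; lra.
apply: compact_closedI; first by apply: compact_setX; exact: segment_compact.
apply: preimage_closed => // p _.
by apply: cvgD; [exact: cvg_fst | exact: cvg_snd].
Qed.

Lemma quadrant_closed : closed (quadrant R).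
Proof.
have -> : quadrant R = (fst @^-1` [set x | 0 <= x]) `&`
    (snd @^-1` [set x | 0 <= x]) by [].
by apply: closedI; apply: preimage_closed => // p _;
  [exact: cvg_fst | exact: cvg_snd].
Qed.

(** Delta0 is the unit ball of the l1 norm within the quadrant, so p is the
    multiple of a point of Delta0 by any factor that bounds its l1 norm. *)
Lemma quadrant_simplex r p : quadrant R p -> p.1 + p.2 <= r ->
  exists2 q, Delta0 R q & p = r *: q.
Proof.
move=> [p1 p2] pr.
have [r0|r0] := leP r 0.
  (* A factor r <= 0 forces p = 0. *)
  exists 0; first by split => /=; lra.
  have x0 : p.1 = 0 by lra.
  have y0 : p.2 = 0 by lra.
  by rewrite scaler0 [p]surjective_pairing x0 y0.
exists (r^-1 *: p); last by rewrite scalerA mulfV ?scale1r ?gt_eqF.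
split => /=; rewrite ?mulr_ge0 ?invr_ge0 ?(ltW r0)//.
rewrite /GRing.scale /= lerBrDr -mulrDr mulrC ler_pdivrMr// mul1r addrC; lra.
Qed.

Lemma Delta0_origin : Delta0 R 0.
Proof. by split => /=; lra. Qed.

Lemma scale_Delta0 (c : R) p : 0 <= c <= 1 -> Delta0 R p -> Delta0 R (c *: p).
Proof.
move=> /andP[c0 c1] [p1 p2 p12]; split => /=; rewrite ?mulr_ge0//.
rewrite /GRing.scale /=. nra.
Qed.

Lemma small_quadrant_Delta0 p : quadrant R p -> `|p| < 2^-1 -> Delta0 R p.
Proof.
move=> [p1 p2] /ltr_normP[]; rewrite !ger0_norm// => ? ?; split => //; lra.
Qed.

Lemma small_notin_Gamma p : `|p| < 2^-1 -> ~ Gamma R p.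
Proof.
move=> /ltr_normP[h1 h2] [x _ px]; rewrite -{}px /= in h1 h2.
move: h1 h2; rewrite !ltr_norml => /andP[? ?] /andP[? ?]; lra.
Qed.

End Plane.

(** * Homogeneous maps whose orbits return to the quadrant *)

Section ConeMap.
Context {R : realType} (f : R * R -> R * R) (N : nat).
Hypotheses (fcont : continuous f) (fhom : positively_homogeneous f)
  (frec : recurrent_within N f).
Implicit Types (p q : R * R) (S : set (R * R)).

Lemma iter_continuous n : continuous (iter n f).
Proof.
elim: n => [|n IH] p; first exact: cvg_id.
apply: (@continuous_comp _ _ _ (iter n f) f); [exact: IH | exact: fcont].
Qed.

Lemma iter_homogeneous n : positively_homogeneous (iter n f).
Proof. by move=> c p c0; elim: n => //= n ->; rewrite fhom. Qed.

Lemma iter_fix0 n : iter n f 0 = 0.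
Proof. by have := iter_homogeneous n (c := 0) 0 (lexx _); rewrite !scale0r. Qed.

Lemma iter_invariant S n : f @` S `<=` S -> forall p, S p -> S (iter n f p).
Proof. by move=> fS p Sp; elim: n => //= n IH; apply: fS; exists (iter n f p). Qed.

Lemma iter_split n j p : (j <= n)%N -> iter n f p = iter (n - j) f (iter j f p).
Proof. by move=> jn; rewrite -iterD subnK. Qed.

Lemma Omega_compact m : compact (Omega f m).
Proof.
rewrite /Omega bigcup_mkord; apply: bigsetU_compact => i _.
apply: continuous_compact Delta0_compact.
by apply: continuous_subspaceT; exact: iter_continuous.
Qed.

(** The multiples of an orbit segment that starts in Delta0 by factors in
    [0, 1] also start in Delta0. This is what turns avoidance of the segment
    Gamma into a bound on the part of a set in the quadrant. *)
Lemma Omega_star m (c : R) p : 0 <= c <= 1 -> Omega f m p -> Omega f m (c *: p).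
Proof.
move=> c01 [i im [q q0 <-]]; exists i => //; exists (c *: q).
  exact: scale_Delta0.
by rewrite iter_homogeneous //; case/andP: c01.
Qed.

Lemma Delta0_Omega m : Delta0 R `<=` Omega f m.
Proof. by move=> p p0; exists 0%N => //; exists p. Qed.

(** Controls the part of an orbit up to its first visit to the
    quadrant, where membership in multiples of Omega gives no information. *)
Lemma small_finite_orbit n (eps : R) : 0 < eps -> exists2 delta : R, 0 < delta &
  forall p, `|p| < delta -> forall i, (i <= n)%N -> `|iter i f p| < eps.
Proof.
move=> e0; elim: n => [|n [d d0 IH]].
  by exists eps => // p pe [|].
have := @iter_continuous n.+1 (0 : R * R); rewrite /continuous_at iter_fix0.
move=> /cvgr0Pnorm_lt/(_ _ e0)/nbhs_norm0P[d' /= d'0 H].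
exists (Num.min d d'); first by rewrite lt_min d0.
move=> p; rewrite lt_min => /andP[pd pd'] i; rewrite leq_eqVlt => /orP[/eqP->|].
  exact: H.
by rewrite ltnS; exact: IH.
Qed.

(** If some point of the image under f^k had l1 norm at least 1 in the
    quadrant, scaling it down would give a point of the image on Gamma. So the
    maximum c of the l1 norm over the compact part of the image in the
    quadrant is below 1. A visit to the quadrant after time k then lies in
    c Delta0, because the delay before the visit can be absorbed into
    Omega f m by invariance. *)
Lemma Omega_contraction m k :
  f @` Omega f m `<=` Omega f m ->
  (iter k f @` Omega f m) `&` Gamma R = set0 ->
  exists2 c : R, 0 <= c < 1 & forall p, Omega f m p ->
    exists2 q, Omega f m q & iter (N + k) f p = c *: q.
Proof.
set S := Omega f m => fS SG.
pose K := (iter k f @` S) `&` quadrant R.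
have K0 : K 0.
  split; last by split => /=.
  by exists 0; [apply: Delta0_Omega; exact: Delta0_origin | rewrite iter_fix0].
have cK : compact K.
  apply: compact_closedI quadrant_closed.
  apply: continuous_compact (@Omega_compact m).
  by apply: continuous_subspaceT; exact: iter_continuous.
have [|p0 /set_mem[[s Ss fsp] [p01 p02]] pmax] :=
    @compact_EVT_max _ R (fun p : R * R => p.1 + p.2) K (ex_intro _ _ K0) cK.
  apply: continuous_subspaceT => p.
  by apply: cvgD; [exact: cvg_fst | exact: cvg_snd].
set c := p0.1 + p0.2 in pmax.
have c0 : 0 <= c by rewrite addr_ge0.
have c1 : c < 1.
  rewrite ltNge; apply/negP => c1.
  have cgt0 : 0 < c by lra.
  (* Rescaling p0 onto Gamma contradicts the avoidance hypothesis. *)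
  have : set0 (c^-1 *: p0).
    rewrite -SG; split.
      exists (c^-1 *: s); first by apply: Omega_star => //; rewrite invr_ge0 c0 invf_le1.
      by rewrite iter_homogeneous ?invr_ge0// fsp.
    have e : c^-1 * p0.1 + c^-1 * p0.2 = 1 by rewrite -mulrDr mulVf// gt_eqF.
    have q1 : 0 <= c^-1 * p0.1 by rewrite mulr_ge0 ?invr_ge0.
    have q2 : 0 <= c^-1 * p0.2 by rewrite mulr_ge0 ?invr_ge0.
    exists (c^-1 * p0.1); first by rewrite /= q1; lra.
    by congr pair; rewrite /= /GRing.scale /=; lra.
  by [].
exists c; first by rewrite c0.
move=> p Sp; have [j jN qj] := frec (iter k f p).
have [||q0 q0D q0E] := @quadrant_simplex _ c (iter j f (iter k f p)) => //.
  apply: pmax; apply/mem_set; split => //.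
  (* The visit occurs at time j + k; reading it as the image under f^k of
     the point f^j p of Omega puts it in the set over which c is a maximum. *)
  exists (iter j f p); first exact: iter_invariant.
  by rewrite -!iterD addnC.
exists (iter (N - j) f q0); first by apply: iter_invariant => //; exact: Delta0_Omega.
by rewrite iterD (@iter_split N j)// q0E iter_homogeneous.
Qed.

(** The orbit of an arbitrary point lands, at a time j <= N, on a multiple
    r q of some q in Delta0, with r at most twice the norm reached at that
    time. From then on the orbit is r times an orbit inside Omega f m: bounded
    by r b if b bounds Omega f m, which gives Lyapunov stability, and geometrically contracted,
    which gives attraction. *)
Lemma stable_of_trapping m k :
  f @` Omega f m `<=` Omega f m ->
  (iter k f @` Omega f m) `&` Gamma R = set0 ->
  asymptotically_stable0 f.
Proof.
move=> fS SG.
have [c /andP[c0 c1] contr] := Omega_contraction fS SG.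
have [b b0 Sb] : exists2 b : R, 0 < b & forall q, Omega f m q -> `|q| <= b.
  have [M [_ HM]] := compact_bounded (@Omega_compact m).
  exists (Num.max 1 (M + 1)) => [|q Sq]; first by rewrite lt_max ltr01.
  by apply: HM => //; rewrite lt_max ltrDl ltr01 orbT.
have land p : exists2 j, (j <= N)%N & exists2 q, Omega f m q &
    iter j f p = ((iter j f p).1 + (iter j f p).2) *: q /\
    0 <= (iter j f p).1 + (iter j f p).2 <= 2 * `|iter j f p|.
  have [j jN qj] := frec p; exists j => //.
  have [q q0 qE] := quadrant_simplex qj (lexx _).
  exists q; first exact: Delta0_Omega.
  split => //; case: qj => p1 p2; rewrite addr_ge0//=.
  have [h1 h2] : `|(iter j f p).1| <= `|iter j f p| /\ `|(iter j f p).2| <= `|iter j f p|.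
    by rewrite prod_normE !le_max !lexx orbT.
  by move: h1 h2; rewrite !ger0_norm// => h1 h2; lra.
split.
  move=> eps e0.
  have e20 : 0 < eps / 2 by rewrite divr_gt0.
  (* The first bound serves before the landing time. The second makes
     r b < eps / 2 after it, as r <= 2 eta. *)
  pose eta := Num.min (eps / 2) (eps / 2 / (2 * b)).
  have [|d d0 Hd] := @small_finite_orbit N eta.
    by rewrite lt_min e20 divr_gt0// mulr_gt0.
  exists d => // p pd n.
  have {pd}/Hd pd : `|p| < d := le_lt_trans (norm_le_eucl _) pd.
  suff h : `|iter n f p| < eps / 2.
    by apply: le_lt_trans (eucl_le_norm _) _; lra.
  have [j jN [q Sq [qE /andP[r0 r1]]]] := land p.
  have [nj|jn] := leqP n j.
    by have := pd n (leq_trans nj jN); rewrite lt_min => /andP[].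
  rewrite (@iter_split n j) ?(ltnW jn)// qE iter_homogeneous// normrZ ger0_norm//.
  have := pd j jN; rewrite lt_min => /andP[_].
  rewrite ltr_pdivlMr ?mulr_gt0// => h.
  have := Sb _ (@iter_invariant _ (n - j) fS _ Sq); set y := `|_| => yb.
  have := normr_ge0 (iter j f p).
  have : 0 <= y by exact: normr_ge0.
  set x := _ + _ in r0 r1 *; set w := `|_| in h r1 * => y0 w0.
  have : x * y <= 2 * w * b by exact: ler_pM.
  lra.
(* Attraction is global, so any radius serves. *)
exists 1 => // p _; apply/cvgr0Pnorm_lt => eps e0.
have pow t q : Omega f m q -> exists2 q', Omega f m q' &
    iter (t * (N + k)) f q = c ^+ t *: q'.
  move=> Sq; elim: t => [|t [q' Sq' q'E]].
    by exists q => //; rewrite mul0n expr0 scale1r.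
  have [q'' Sq'' q''E] := contr _ Sq'.
  exists q'' => //.
  by rewrite mulSn iterD q'E iter_homogeneous ?exprn_ge0// q''E scalerA exprSr.
have [j jN [q Sq [qE /andP[r0 _]]]] := land p.
set r := _ + _ in r0 qE.
have [T HT] : exists t : nat, c ^+ t * (r * b) < eps.
  have : c ^+ t @[t --> \oo] --> 0 by apply: cvg_expr; rewrite ger0_norm.
  have rb : 0 < r * b + 1 by rewrite ltr_wpDl// mulr_ge0// ltW.
  move=> /cvgr0Pnorm_lt/(_ (eps / (r * b + 1)) (divr_gt0 e0 rb)) [T _ /(_ T (leqnn _))].
  rewrite /= ger0_norm ?exprn_ge0// ltr_pdivlMr// => h; exists T.
  by apply: le_lt_trans h; rewrite ler_wpM2l ?exprn_ge0// lerDl.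
exists (j + T * (N + k))%N => // n /= nT.
have jn : (j <= n)%N by exact: leq_trans (leq_addr _ _) nT.
have Tn : (T * (N + k) <= n - j)%N by rewrite leq_subRL.
rewrite (@iter_split n j)// qE iter_homogeneous//.
rewrite (@iter_split (n - j) (T * (N + k)))//.
have [q' Sq' ->] := pow T q Sq.
rewrite iter_homogeneous ?exprn_ge0// scalerA normrZ ger0_norm ?mulr_ge0 ?exprn_ge0//.
apply: le_lt_trans HT; rewrite (mulrC r) -mulrA !ler_wpM2l ?exprn_ge0//.
by apply: Sb; exact: iter_invariant.
Qed.

(** By homogeneity local attraction is global, so each orbit enters the ball
    from which Lyapunov stability keeps it eps-small for ever. Entering it at a
    given time is an open condition on the starting point, so compactness
    bounds the entry time. *)
Lemma uniform_attraction (K : set (R * R)) (eps : R) :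
  asymptotically_stable0 f -> compact K -> 0 < eps ->
  exists M : nat, forall p n, K p -> (M <= n)%N -> `|iter n f p| < eps.
Proof.
move=> [lyap [d0 d0gt0 attr]] /compact_near_coveringP cK e0.
have [d d_gt0 Hd] := lyap _ e0.
have visit p : exists M, `|iter M f p| < d / 2.
  (* This factor brings p into the basin of radius d0. *)
  pose c : R := d0 / 2 / (2 * (`|p| + 1)).
  have p1 : 0 < `|p| + 1 by rewrite ltr_wpDl.
  have c_gt0 : 0 < c by rewrite !divr_gt0 ?mulr_gt0.
  have cp : eucl_ball d0 (c *: p).
    apply: le_lt_trans (eucl_le_norm _) _.
    rewrite normrZ gtr0_norm//.
    have : c * (2 * (`|p| + 1)) = d0 / 2 by rewrite divfK// mulf_neq0// gt_eqF.
    by have := normr_ge0 p; nra.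
  have := attr _ cp => /cvgr0Pnorm_lt/(_ (c * (d / 2))).
  case; first by rewrite mulr_gt0// divr_gt0.
  move=> M _ /(_ M (leqnn _)) /=.
  by rewrite iter_homogeneous ?(ltW c_gt0)// normrZ gtr0_norm// ltr_pM2l//; exists M.
have := cK nat \oo (fun M p => forall n, (M <= n)%N -> `|iter n f p| < eps).
case=> [p _|M _ /(_ M (leqnn _)) HM].
  have [M HM] := visit p.
  have U : \forall p' \near p, `|iter M f p'| < d / 2.
    have := @iter_continuous M p => /cvg_norm /cvgr_lt; exact.
  exists ([set p' | `|iter M f p'| < d / 2], [set n | (M <= n)%N]).
    by split => //=; exists M.
  move=> [p' i] /= [p'M Mi] n im.
  rewrite (@iter_split n M) ?(leq_trans Mi)//.
  apply: le_lt_trans (norm_le_eucl _) _; apply: Hd.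
  apply: le_lt_trans (eucl_le_norm _) _; lra.
by exists M => p n Kp; exact: HM.
Qed.

(** The radius 1/2 serves twice: a point of norm less than 1/2 is off Gamma,
    and it lies in Delta0 as soon as it lies in the quadrant. The invariant
    union stops at M + N: M iterations make the images of Delta0 that small,
    and N more allow for the return to the quadrant. *)
Lemma trapping_of_stable : asymptotically_stable0 f -> exists m k : nat,
  f @` Omega f m `<=` Omega f m /\ (iter k f @` Omega f m) `&` Gamma R = set0.
Proof.
move=> st.
have [M HM] := @uniform_attraction _ 2^-1 st Delta0_compact (ltac:(lra)).
exists (M + N)%N, M; split.
  move=> _ [_ [i /= im [q q0 <-]] <-].
  move: im; rewrite ltnS leq_eqVlt => /orP[/eqP->|im]; last first.
    by exists i.+1 => //; exists q.
  (* The last iterate f^(M + N + 1) q is the only one that may leave Omega.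
     The orbit visits the quadrant between the times M + 1 and M + N + 1, at a
     point small enough to be in Delta0, so at most N steps before. *)
  have [j jN qj] := frec (iter M.+1 f q).
  exists (N - j)%N; first by rewrite /= ltnS (leq_trans (leq_subr _ _)) ?leq_addl.
  exists (iter j f (iter M.+1 f q)).
    apply: small_quadrant_Delta0 => //; rewrite -iterD; apply: HM => //.
    by rewrite addnS leqW// leq_addl.
  by rewrite -iter_split// -iterD -iterS addnS addnC.
rewrite -subset0 => _ [[_ [i _ [q q0 <-]] <-]] /=.
by apply: small_notin_Gamma; rewrite -iterD; apply: HM; rewrite ?leq_addr.
Qed.

End ConeMap.

(** * The piecewise linear map *)

Section Gmap.
Context {R : realType} (tauL deltaL tauR deltaR : R).
Let g := gmap tauL deltaL tauR deltaR.

Lemma gmap_homogeneous : positively_homogeneous g.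
Proof.
move=> c p; rewrite le_eqVlt => /orP[/eqP<-|c0].
  by rewrite !scale0r /g /gmap /= lexx !mulr0 addr0.
rewrite /g /gmap /= /GRing.scale /= pmulr_rle0//.
by case: ifP => _; congr pair; rewrite /= /GRing.scale /=; lra.
Qed.

(** A formula without case distinction, from which continuity is immediate. *)
Lemma gmap_normE p : g p =
  ((tauL + tauR) / 2 * p.1 + (tauR - tauL) / 2 * `|p.1| + p.2,
   - (deltaL + deltaR) / 2 * p.1 + (deltaL - deltaR) / 2 * `|p.1|).
Proof.
rewrite /g /gmap; case: ifPn => [p1|/negP p1].
  by rewrite ler0_norm//; congr pair; lra.
by rewrite ger0_norm; [congr pair; lra | lra].
Qed.

Lemma gmap_continuous : continuous g.
Proof.
have -> : g = fun p => _ := funext gmap_normE.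
have c1 (p : R * R) : q.1 @[q --> p] --> p.1 by exact: cvg_fst.
have c2 (p : R * R) : `|q.1| @[q --> p] --> `|p.1|.
  by apply: cvg_norm; exact: c1.
move=> p; apply: (@cvg_pair _ _ _ (nbhs p) (nbhs _) (nbhs _)) => /=; last first.
  by apply: cvgD; (apply: cvgM; first exact: cvg_cst); [exact: c1 | exact: c2].
apply: cvgD; last exact: cvg_snd.
by apply: cvgD; (apply: cvgM; first exact: cvg_cst); [exact: c1 | exact: c2].
Qed.

Hypotheses (hdeltaL : 0 < deltaL) (hdeltaR : deltaR < 0)
  (htauL : tauL < 2 * Num.sqrt deltaL).

Lemma gmap_snd_ge0 p : 0 <= (g p).2.
Proof. 
rewrite /g /gmap; case: ifPn => [p0|]; last rewrite -ltNge => p0 /=.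
  by rewrite /= mulNr -mulrN mulr_ge0 ?oppr_ge0 ?(ltW hdeltaL).
by rewrite mulr_ge0 ?oppr_ge0 ?(ltW hdeltaR) ?(ltW p0). Qed.

(** For a point (-a, y) with a > 0 the slope is s = y / a, and its image is
    (-b, deltaL a) with b = tauL a - y. While b > 0, the ratio r = b / a is
    tauL - s, and the slope of the image is
    deltaL / r >= 2 sqrt deltaL - r = s + (2 sqrt deltaL - tauL),
    the inequality being (sqrt deltaL - r)^2 >= 0. So each step spent in the
    left half plane raises the slope by a fixed positive amount. *)
Lemma gmap_slope_step (s : R) p : p.1 < 0 -> s * - p.1 <= p.2 -> (g p).1 < 0 ->
  (s + (2 * Num.sqrt deltaL - tauL)) * - (g p).1 <= (g p).2.
Proof.
move=> p0; rewrite /g /gmap (ltW p0) /=.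
have := sqr_sqrtr (ltW hdeltaL); set d := Num.sqrt deltaL => dE.
move=> sp x1; rewrite -dE.
set a := - p.1; have a0 : 0 < a by rewrite oppr_gt0.
have -> : p.1 = - a by rewrite opprK.
set b := - (tauL * p.1 + p.2).
have b0 : 0 < b by rewrite oppr_gt0.
have bE : b = tauL * a - p.2 by rewrite /b /a; lra.
have -> : - (tauL * - a + p.2) = b by rewrite bE; lra.
rewrite mulrNN -(ler_pM2r a0).
have h : (s + (2 * d - tauL)) * a <= 2 * d * a - b by rewrite bE -/a in sp *; lra.
have := ler_wpM2r (ltW b0) h.
have := sqr_ge0 (d * a - b).
by rewrite !expr2; lra.
Qed.

(** After one step the orbit is in the upper half plane and stays there, with
    slope at least 0. As long as it remains in x < 0 the slope grows linearly
    in time ([gmap_slope_step]), and once the slope exceeds tauL the next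
    point has x > 0. *)
Lemma gmap_recurrent : exists N, recurrent_within N g.
Proof.
set e := 2 * Num.sqrt deltaL - tauL.
have e0 : 0 < e by rewrite subr_gt0.
pose M := Num.bound `|tauL / e|.
have Me : tauL < M%:R * e.
  rewrite -ltr_pdivrMr//; apply: le_lt_trans (ler_norm _) _.
  exact/archi_boundP/normr_ge0.
exists M.+2 => p0.
suff [j jM j0] : exists2 j, (j <= M.+1)%N & 0 <= (iter j g (g p0)).1.
  exists j.+1 => //; rewrite iterSr; split => //.
  by case: j {jM j0} => [|j] /=; exact: gmap_snd_ge0.
have : 0 <= (g p0).2 by exact: gmap_snd_ge0.
move: (g p0) => p p2.
apply: contrapT => /forall2NP H.
have neg j : (j <= M.+1)%N -> (iter j g p).1 < 0.
  by move=> jM; have [//|] := H j; rewrite ltNge => /negP.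
have slope n : (n <= M)%N -> n%:R * e * - (iter n g p).1 <= (iter n g p).2.
  elim: n => [_|n IH nM]; first by rewrite !mul0r.
  rewrite -addn1 natrD mulrDl mul1r addn1.
  apply: gmap_slope_step; [exact/neg/leqW/ltnW | exact/IH/ltnW |].
  exact: (neg n.+1 (leqW nM)).
have := neg M.+1 (leqnn _); rewrite /= {1}/g /gmap.
have := neg M (leqnSn _) => x0; rewrite (ltW x0) /=.
have := slope M (leqnn _).
by set x := (_).1 in x0 *; nra.
Qed.

End Gmap.

Theorem theorem6p4 (R : realType) (tauL deltaL tauR deltaR : R)
    (hdeltaL : 0 < deltaL) (hdeltaR : deltaR < 0)
    (htauL : tauL < 2 * Num.sqrt deltaL) :
  let g := gmap tauL deltaL tauR deltaR in
  (g (0, 0) = (0, 0) /\ asymptotically_stable0 g) <->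
  (exists m k : nat,
     g @` Omega g m `<=` Omega g m /\
     (iter k g @` Omega g m) `&` Gamma R = set0).
Proof.
move=> g.
have gc : continuous g by exact: gmap_continuous.
have gh : positively_homogeneous g by exact: gmap_homogeneous.
have [N gr] := gmap_recurrent tauR hdeltaL hdeltaR htauL.
split=> [[_ st]|[m [k [inv cross]]]]; first exact: (trapping_of_stable gc gh gr st).
by split; [exact: (iter_fix0 gh 1) | exact: (stable_of_trapping gc gh gr inv cross)].
Qed.
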